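(* Let $P\subset\mathbb{R}^2$ be a convex polygon and let $\mathcal S=\{S_1,\ldots,S_m\}$ be a simply connected self-affine $P$-polygonal system in $\mathbb{R}^2$ (consisting of invertible affine contractions) with attractor $K$. Then there exist constants $C>0$ and $\lambda\in(0,1)$ such that for all $x,y\in K$ the subarc $\gamma(x,y)\subset K$ with endpoints $x,y$ satisfies $$\operatorname{diam}(\gamma(x,y))\le C\,\|x-y\|^{\lambda}.$$
   Context: Let $P$ be a convex polygon in $\mathbb{R}^2$ (with nonempty interior; $P$ denotes the closed region) with vertex set $V=\{A_1,\ldots,A_n\}$, and let $I=\{1,\ldots,m\}$. A system $\mathcal S=\{S_1,\ldots,S_m\}$ of affine contractive maps of $\mathbb{R}^2$ is called a simply connected self-affine $P$-polygonal system if: 1) for every $i\in I$, $S_i(P)\subset P$; 2) $\bigcup_{i\in I}S_i(V)\supset V$; 3) for all $i\ne j$ in $I$, $S_i(P)\cap S_j(P)=S_i(V)\cap S_j(V)$ and $\#\big(S_i(V)\cap S_j(V)\big)\le 1$; 4) the set $\bigcup_{i\in I}S_i(P)$ is simply connected (in particular connected). The maps $S_i$ are assumed invertible. A map is contractive if it is Lipschitz with constant $<1$ for the Euclidean norm $\|\cdot\|$. The attractor $K$ of $\mathcal S$ is the unique nonempty compact set with $K=\bigcup_{i\in I}S_i(K)$. A dendrite is a locally connected continuum that contains no simple closed curve. The attractor $K$ of such a system is a dendrite, so for any $x,y\in K$ there is a unique arc in $K$ with endpoints $x,y$; it is denoted $\gamma(x,y)$ (with $\gamma(x,x)=\{x\}$).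 *)

(* Defs.v *)
From mathcomp Require Import all_boot all_order all_algebra.
From mathcomp Require Import all_classical all_reals all_analysis.

Set Implicit Arguments.
Unset Strict Implicit.
Unset Printing Implicit Defensive.

Import Order.TTheory GRing.Theory Num.Theory.
Import numFieldNormedType.Exports.

Local Open Scope classical_set_scope.
Local Open Scope ring_scope.

(* The library norm on 'rV[R]_2 is the sup norm: it provides the topology,
   while all metric notions below use the Euclidean norm. *)
Definition enorm (R : realType) (v : 'rV[R]_2) : R :=
  Num.sqrt (\sum_(i < 2) v ord0 i ^+ 2).

Definition diam (R : realType) (A : set 'rV[R]_2) : \bar R :=
  ereal_sup [set (enorm (u.1 - u.2))%:E | u in A `*` A].

Definition affine_map (R : realType) (f : 'rV[R]_2 -> 'rV[R]_2) : Prop :=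
  exists (M : 'M[R]_2) (b : 'rV[R]_2), forall x, f x = x *m M + b.

Definition contractive (R : realType) (f : 'rV[R]_2 -> 'rV[R]_2) : Prop :=
  exists q : R, 0 <= q < 1 /\
    forall x y, enorm (f x - f y) <= q * enorm (x - y).

Definition convex_hull (R : realType) (A : set 'rV[R]_2) : set 'rV[R]_2 :=
  smallest (fun B : set 'rV[R]_2 => convex_set B) A.

(* P is a convex polygon with nonempty interior and V is its set of vertices:
   the third clause says that no point of V is redundant. *)
Definition convex_polygon (R : realType) (P V : set 'rV[R]_2) : Prop :=
  [/\ finite_set V,
      P = convex_hull V,
      forall v, V v -> ~ convex_hull (V `\ v) v
    & P° !=set0].

Definition path_connected (R : realType) (X : set 'rV[R]_2) : Prop :=
  forall x y, X x -> X y -> exists f : R -> 'rV[R]_2,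
    [/\ {within `[0, 1], continuous f}, f @` `[0, 1] `<=` X,
        f 0 = x & f 1 = y].

(* In the homotopy H, the first variable runs along the loop and the second
   one is the deformation parameter; the base point f 0 is kept fixed. *)
Definition simply_connected (R : realType) (X : set 'rV[R]_2) : Prop :=
  path_connected X /\
  forall f : R -> 'rV[R]_2,
    {within `[0, 1], continuous f} -> f @` `[0, 1] `<=` X -> f 0 = f 1 ->
    exists H : R * R -> 'rV[R]_2,
      [/\ {within `[0, 1] `*` `[0, 1], continuous H},
          H @` (`[0, 1] `*` `[0, 1]) `<=` X,
          forall s : R, 0 <= s <= 1 -> H (s, 0) = f s /\ H (s, 1) = f 0
        & forall t : R, 0 <= t <= 1 -> H (0, t) = f 0 /\ H (1, t) = f 0].

Record sc_polygonal_system (R : realType) (P V : set 'rV[R]_2) (m : nat)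
    (S : 'I_m -> 'rV[R]_2 -> 'rV[R]_2) : Prop := {
  sys_affine : forall i, affine_map (S i);
  sys_contractive : forall i, contractive (S i);
  sys_invertible : forall i, bijective (S i);
  sys_sub : forall i, S i @` P `<=` P;
  sys_vertices : V `<=` \bigcup_i (S i @` V);
  sys_inter : forall i j : 'I_m, i != j ->
    S i @` P `&` S j @` P = S i @` V `&` S j @` V;
  sys_inter_le1 : forall i j : 'I_m, i != j -> is_subset1 (S i @` V `&` S j @` V);
  sys_simply_connected : simply_connected (\bigcup_i (S i @` P))
}.

Definition attractor (R : realType) (m : nat)
    (S : 'I_m -> 'rV[R]_2 -> 'rV[R]_2) (K : set 'rV[R]_2) : Prop :=
  [/\ K !=set0, compact K & K = \bigcup_i (S i @` K)].

(* G is an arc with endpoints x and y, a single point being allowed as the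
   degenerate arc when x = y. Since [0, 1] is compact, a continuous injection
   of it is a homeomorphism onto its image. *)
Definition is_arc (R : realType) (x y : 'rV[R]_2) (G : set 'rV[R]_2) : Prop :=
  (x = y /\ G = [set x]) \/
  exists f : R -> 'rV[R]_2,
    [/\ {within `[0, 1], continuous f}, set_inj `[0, 1] f,
        f 0 = x, f 1 = y & G = f @` `[0, 1]].

(* Main.v *)
(** Write x, y in K as images of points x', y' under the longest common cylinder
    map. If 0 < r < q < 1 bound the expansion of the S_i from below and above,
    then pulling an arc back by some S_i preserves the estimate
    diam <= C |x - y|^l for l = ln q / ln r, so only arcs whose end points lie
    in no common piece S_i(K) matter. If these end points x in S_i(P) and
    y in S_k(P) lie in disjoint polygons, |x - y| is bounded below. Otherwise
    the polygons meet in a common vertex p at a positive angle, so |x - p| and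
    |y - p| are O(|x - y|), the arc passes through p, and the estimate reduces to
    arcs ending at a vertex; for these the same descent ends with two points at
    a distance bounded below, because a vertex outside S_i(P) is far from it.

    That an arc stays in a polygon containing its end points, and passes through
    p in the second case, comes from simple connectedness: an excursion out of
    S_i(P), closed up by a segment inside S_i(P), would be a loop on which a tent
    function centred at one of its ends on S_i(P), which is integral at all other
    contact points and hence continuous modulo 1, has winding number one. *)
Require Import Defs.
From mathcomp Require Import all_boot all_order all_algebra.
From mathcomp Require Import all_classical all_reals all_analysis.
From mathcomp Require Import zify ring lra.

Import Order.TTheory GRing.Theory Num.Theory.
Import numFieldNormedType.Exports.

Local Open Scope classical_set_scope.
Local Open Scope ring_scope.

Set Implicit Arguments.
Unset Strict Implicit.

(** * Euclidean norm and its comparison with the sup norm *)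

Section EuclideanNorm.
Variable R : realType.
Implicit Types u v w : 'rV[R]_2.

Lemma enorm_sq v : enorm v ^+ 2 = v ord0 ord0 ^+ 2 + v ord0 ord_max ^+ 2.
Proof.
rewrite /enorm big_ord_recl big_ord1 sqr_sqrtr ?addr_ge0 ?sqr_ge0 //.
by congr (_ + v _ _ ^+ _); apply/val_inj.
Qed.

Lemma enorm_ge0 v : 0 <= enorm v.
Proof. exact: sqrtr_ge0. Qed.

Lemma enormD u v : enorm (u + v) <= enorm u + enorm v.
Proof.
have u0 := enorm_ge0 u; have v0 := enorm_ge0 v.
rewrite -(@ler_pXn2r _ 2) ?nnegrE ?enorm_ge0 ?addr_ge0 // sqrrD !enorm_sq !mxE.
have := enorm_sq u; have := enorm_sq v.
move: (enorm u) (enorm v) u0 v0 (u ord0 ord0) (u ord0 ord_max) (v ord0 ord0)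
  (v ord0 ord_max) => A B A0 B0 a b c d hB hA.
(* Cauchy-Schwarz in two coordinates, by Lagrange's identity. *)
have : a * c + b * d <= A * B.
  apply: (le_trans (ler_norm _)).
  rewrite -(@ler_pXn2r _ 2) ?nnegrE ?mulr_ge0 // real_normK ?num_real //.
  rewrite exprMn hA hB -subr_ge0.
  have -> : (a ^+ 2 + b ^+ 2) * (c ^+ 2 + d ^+ 2) - (a * c + b * d) ^+ 2 =
     (a * d - b * c) ^+ 2 by ring.
  exact: sqr_ge0.
by move=> h; rewrite -subr_ge0; nra.
Qed.

Lemma enormZ a v : enorm (a *: v) = `|a| * enorm v.
Proof.
apply/eqP; rewrite -(@eqrXn2 _ 2) ?mulr_ge0 ?enorm_ge0 //.
rewrite exprMn !enorm_sq !mxE real_normK ?num_real //; apply/eqP; ring.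
Qed.

Lemma enormN v : enorm (- v) = enorm v.
Proof. by rewrite -scaleN1r enormZ normrN1 mul1r. Qed.

Lemma enormBC u v : enorm (u - v) = enorm (v - u).
Proof. by rewrite -enormN opprB. Qed.

Lemma enorm0 : enorm (0 : 'rV[R]_2) = 0.
Proof. by rewrite -(scale0r 0) enormZ normr0 mul0r. Qed.

Lemma enormB_le u v w : enorm (u - w) <= enorm (u - v) + enorm (v - w).
Proof. by rewrite -(subrKA v); exact: enormD. Qed.

Lemma coord_le_enorm v i : `|v ord0 i| <= enorm v.
Proof.
rewrite -(@ler_pXn2r _ 2) ?nnegrE ?enorm_ge0 // real_normK ?num_real // enorm_sq.
have [->|->] : i = ord0 \/ i = ord_max.
- by case: i => -[|[|//]] h; [left|right]; apply/val_inj.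
- by rewrite lerDl sqr_ge0.
- by rewrite lerDr sqr_ge0.
Qed.

Lemma enorm_le_coord v : enorm v <= `|v ord0 ord0| + `|v ord0 ord_max|.
Proof.
rewrite -(@ler_pXn2r _ 2) ?nnegrE ?enorm_ge0 ?addr_ge0 // enorm_sq sqrrD.
rewrite !real_normK ?num_real // addrAC lerDl mulrn_wge0 //.
Qed.

(** The two comparisons with the sup norm, which carries the topology, transfer limits and
    continuity to Euclidean distances. *)
Lemma mxnorm_le_enorm v : `|v| <= enorm v.
Proof.
rewrite [`|v|]mx_normrE; apply/bigmax_leP; split=> [|[i j] _ /=]; first exact: enorm_ge0.
by rewrite (ord1 i) coord_le_enorm.
Qed.

Lemma enorm_le_mxnorm v : enorm v <= 2 * `|v|.
Proof.
have h i : `|v ord0 i| <= `|v|.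
  by rewrite [`|v|]mx_normrE; exact: (le_bigmax _ (fun ij => `|v ij.1 ij.2|) (ord0, i)).
rewrite (le_trans (enorm_le_coord v)) // mulrDl mul1r lerD //.
Qed.

Lemma enorm_eq0 v : enorm v = 0 -> v = 0.
Proof.
move=> h; apply/normr0_eq0/eqP; rewrite eq_le normr_ge0 andbT -h.
by rewrite mxnorm_le_enorm.
Qed.

Lemma enorm_gt0 u v : u <> v -> 0 < enorm (u - v).
Proof.
move=> uv; rewrite lt_neqAle enorm_ge0 andbT eq_sym; apply/eqP.
by move/enorm_eq0/eqP; rewrite subr_eq0 => /eqP.
Qed.

Lemma enorm_mulmx (M : 'M[R]_2) :
  exists2 L : R, 0 < L & forall v, enorm (v *m M) <= L * enorm v.
Proof.
pose c j := `|M ord0 j| + `|M ord_max j|.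
have h v j : `|(v *m M) ord0 j| <= c j * enorm v.
  rewrite !mxE big_ord_recl big_ord1 (le_trans (ler_normD _ _)) // !normrM.
  rewrite (_ : lift _ _ = ord_max); last exact/val_inj.
  by rewrite mulrDl; apply: lerD; rewrite mulrC ler_wpM2l // coord_le_enorm.
have c0 j : 0 <= c j by rewrite addr_ge0.
exists (c ord0 + c ord_max + 1); first by rewrite ltr_wpDl // addr_ge0.
move=> v; rewrite (le_trans (enorm_le_coord _)) //.
rewrite (le_trans (lerD (h v ord0) (h v ord_max))) // -mulrDl.
by rewrite ler_wpM2r ?enorm_ge0 // lerDl.
Qed.

Lemma enorm_continuous_dist (T : topologicalType) (f g : T -> 'rV[R]_2) :
  continuous f -> continuous g -> continuous (fun x => enorm (f x - g x)).
Proof.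
move=> cf cg x; apply/cvgrPdist_lt => e e0.
have e4 : 0 < e / 4 by rewrite divr_gt0.
have := (cf x); move/cvgrPdist_lt/(_ _ e4) => hf.
have := (cg x); move/cvgrPdist_lt/(_ _ e4) => hg.
near=> y.
have h u v : `|enorm u - enorm v| <= enorm (u - v).
  rewrite ler_norml; apply/andP; split.
    by rewrite lerBDl -lerBDr opprK addrC enormBC -{1}(subrK u v) enormD.
  by rewrite lerBDr -{1}(subrK v u) enormD.
apply: (le_lt_trans (h _ _)); apply: (le_lt_trans (enorm_le_mxnorm _)).
have hfy : `|f x - f y| < e / 4 by near: y.
have hgy : `|g x - g y| < e / 4 by near: y.
have -> : f x - g x - (f y - g y) = f x - f y - (g x - g y).
  by rewrite !opprB [g y - f y]addrC [g y - _]addrC addrACA.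
have := ler_normB (f x - f y) (g x - g y); lra.
Unshelve. all: by end_near. Qed.

Lemma compact_enorm_dist (A B : set 'rV[R]_2) :
  compact A -> compact B -> A `&` B = set0 ->
  exists2 c : R, 0 < c & forall a b, A a -> B b -> c <= enorm (a - b).
Proof.
move=> cA cB AB.
have [[u0 ABu0]|AB0] := pselect ((A `*` B) !=set0); last first.
  by exists 1 => // a b Aa Bb; case: AB0; exists (a, b).
have cf : {within A `*` B, continuous (fun u : 'rV[R]_2 * 'rV[R]_2 => enorm (u.1 - u.2))}.
  apply: continuous_subspaceT; apply: enorm_continuous_dist => x; first exact: cvg_fst.
  exact: cvg_snd.
have [[a b]] := compact_EVT_min (ex_intro _ u0 ABu0) (compact_setX cA cB) cf.
rewrite inE => -[/= Aa Bb] h; exists (enorm (a - b)).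
  apply: enorm_gt0 => ab; have : (A `&` B) a by split=> //; rewrite ab.
  by rewrite AB.
by move=> a' b' Aa' Bb'; apply: (h (a', b')); rewrite inE.
Qed.

Lemma compact_enorm_bounded (A B : set 'rV[R]_2) : compact A -> compact B ->
  exists2 D : R, 0 < D & forall a b, A a -> B b -> enorm (a - b) <= D.
Proof.
move=> cA cB.
have [[u0 ABu0]|AB0] := pselect ((A `*` B) !=set0); last first.
  by exists 1 => // a b Aa Bb; case: AB0; exists (a, b).
have cf : {within A `*` B, continuous (fun u : 'rV[R]_2 * 'rV[R]_2 => enorm (u.1 - u.2))}.
  apply: continuous_subspaceT; apply: enorm_continuous_dist => x; first exact: cvg_fst.
  exact: cvg_snd.
have [[a b]] := compact_EVT_max (ex_intro _ u0 ABu0) (compact_setX cA cB) cf.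
(* Adding 1 keeps the bound positive even when the largest distance is 0. *)
rewrite inE => -[/= Aa Bb] h; exists (enorm (a - b) + 1).
  by rewrite ltr_wpDl // enorm_ge0.
move=> a' b' Aa' Bb'; rewrite (le_trans (h (a', b') _)) ?inE //=.
by rewrite lerDl.
Qed.

Lemma closed_enorm_adherent (A : set 'rV[R]_2) x : closed A ->
  (forall e, 0 < e -> exists2 a, A a & enorm (x - a) < e) -> A x.
Proof.
move=> cA h; apply: cA => U /nbhs_ballP[e /= e0 xe].
have [a Aa xa] := h _ e0; exists a; split=> //; apply: xe.
rewrite -ball_normE /=; exact: le_lt_trans (mxnorm_le_enorm _) xa.
Qed.

End EuclideanNorm.

(** * Convex hulls of finite sets and their cones at a vertex *)

Section ConvexHulls.
Variable R : realType.
Implicit Types (A F Q : set 'rV[R]_2) (u v w p : 'rV[R]_2).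

Lemma convex_set_combo A : convex_set (A : set (convex_lmodType 'rV[R]_2)) <->
  forall x y t, 0 <= t <= 1 -> A x -> A y -> A (t *: x + (1 - t) *: y).
Proof.
split=> [cA x y t /andP[t0 t1] Ax Ay|cA x y t].
  have := cA x y (Itv01 t0 t1); rewrite !inE; exact.
rewrite !inE => Ax Ay; apply: cA => //.
by rewrite ge0 le1.
Qed.

Lemma convex_hull_convex A x y t : 0 <= t <= 1 ->
  convex_hull A x -> convex_hull A y -> convex_hull A (t *: x + (1 - t) *: y).
Proof.
move=> t01 hx hy B [/= cB AB]; apply: (convex_set_combo B).1 => //.
  exact: hx.
exact: hy.
Qed.

(** The apex is added separately so that the join with an empty [F] is still [p]; the hull of a
    single point needs this. *)
Definition cone_join p F := p |` [set u | exists t w,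
  [/\ 0 <= t <= 1, F w & u = t *: w + (1 - t) *: p]].

Lemma cone_join_convex p F :
  (forall x y t, 0 <= t <= 1 -> F x -> F y -> F (t *: x + (1 - t) *: y)) ->
  forall x y t, 0 <= t <= 1 -> cone_join p F x -> cone_join p F y ->
    cone_join p F (t *: x + (1 - t) *: y).
Proof.
move=> cF x y t /andP[t0 t1].
have key a b u v : 0 <= a <= 1 -> 0 <= b <= 1 -> F u -> F v ->
    cone_join p F (t *: (a *: u + (1 - a) *: p) +
      (1 - t) *: (b *: v + (1 - b) *: p)).
  move=> /andP[a0 a1] /andP[b0 b1] Fu Fv; right.
  (* [T] is the total weight carried by [F]. If it is 0 the combination is [p]; otherwise it is a
     cone point over the barycentre of [u] and [v] with weights proportional to [t * a] and
     [(1 - t) * b]. *)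
  pose T := t * a + (1 - t) * b.
  have ta0 : 0 <= t * a by rewrite mulr_ge0.
  have tb0 : 0 <= (1 - t) * b by rewrite mulr_ge0 // subr_ge0.
  have [T0|T0] := eqVneq T 0.
    exists 0, u; split=> //; first by rewrite lexx ler01.
    have /eqP := T0; rewrite paddr_eq0 // => /andP[/eqP h1 /eqP h2].
    rewrite !scalerDr !scalerA h1 h2 !scale0r !add0r -scalerDl; congr (_ *: _).
    by rewrite !mulrBr h1 h2; ring.
  have Tgt0 : 0 < T by rewrite lt_neqAle eq_sym T0 addr_ge0.
  exists T, (t * a / T *: u + (1 - t * a / T) *: v); split.
  - rewrite ltW //= /T; nra.
  - apply: cF => //; rewrite divr_ge0 ?(ltW Tgt0) //= ler_pdivrMr // mul1r /T.
    by rewrite lerDl.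
  - have hv : T * (1 - t * a / T) = (1 - t) * b.
      by rewrite mulrBr mulr1 mulrC divfK // /T addrC addKr.
    rewrite [in RHS]scalerDr !scalerA hv [T * _]mulrC divfK //.
    by apply/rowP => i; rewrite !mxE /T; ring.
(* The apex is a cone point of weight 0 over any base point, which reduces the mixed cases to
   [key]. *)
have pE w : p = 0 *: w + (1 - 0) *: p by rewrite scale0r add0r subr0 scale1r.
have h01 : 0 <= (0 : R) <= 1 by rewrite lexx ler01.
case=> [->|[a [u [a01 Fu ->]]]]; case=> [->|[b [v [b01 Fv ->]]]].
- by left; rewrite -scalerDl subrKC scale1r.
- by rewrite [X in t *: X](pE v); exact: key.
- by rewrite [X in (1 - t) *: X](pE u); exact: key.
- exact: key.
Qed.

Lemma convex_hull_setU1 p A : convex_hull (p |` A) = cone_join p (convex_hull A).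
Proof.
apply/seteqP; split.
  apply: smallest_sub.
    by apply/convex_set_combo; apply: cone_join_convex; exact: convex_hull_convex.
  move=> x [->|Ax]; [by left|right]; exists 1, x; split.
  - by rewrite ler01 lexx.
  - exact: sub_gen_smallest.
  - by rewrite scale1r subrr scale0r addr0.
have pA : convex_hull (p |` A) p by apply: sub_gen_smallest; left.
move=> x [->//|[t [w [t01 Fw ->]]]]; apply: convex_hull_convex => //.
move: Fw; apply: smallest_sub; last by move=> z Az; apply: sub_gen_smallest; right.
by apply/convex_set_combo; exact: convex_hull_convex.
Qed.

Lemma convex_hull_set0 : convex_hull (set0 : set 'rV[R]_2) = set0.
Proof.
by rewrite -subset0; apply: smallest_sub => //; apply/convex_set_combo.
Qed.

Lemma cone_join_compact p F : compact F -> compact (cone_join p F).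
Proof.
move=> cF; apply: compactU; first exact: compact_set1.
have -> : [set u | exists t w, [/\ 0 <= t <= 1, F w & u = t *: w + (1 - t) *: p]] =
   (fun z : R * 'rV[R]_2 => z.1 *: z.2 + (1 - z.1) *: p) @` (`[0, 1] `*` F).
  apply/seteqP; split=> [u [t [w [t01 Fw ->]]]|u [[t w] [/= + Fw] <-]].
    by exists (t, w) => //; split=> //=; rewrite in_itv.
  by rewrite in_itv /= => t01; exists t, w.
apply: continuous_compact; last by apply: compact_setX => //; exact: segment_compact.
apply: continuous_subspaceT => z; apply: cvgD.
  by apply: cvgZ; [exact: cvg_fst|exact: cvg_snd].
by apply: cvgZr_tmp; apply: cvgB; [exact: cvg_cst|exact: cvg_fst].
Qed.

(** Points are added one at a time: each new hull is a cone over the previous one, the continuous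
    image of a compact product together with the apex. *)
Lemma convex_hull_compact A : finite_set A -> compact (convex_hull A).
Proof.
move=> /finite_seqP[s ->]; elim: s => [|p s IHs].
  by rewrite set_nil convex_hull_set0; exact: compact0.
have -> : [set` p :: s] = p |` [set` s].
  apply/seteqP; split=> x /=; rewrite inE.
    by move=> /orP[/eqP|]; [left|right].
  by case=> [->|->]; rewrite ?eqxx ?orbT.
by rewrite convex_hull_setU1; exact: cone_join_compact.
Qed.

(** Local model of a polygon at a vertex [p]: star-shaped about [p], and a cone over a compact base
    that misses [p]. No angle appears, so affine bijections preserve the notion. *)
Definition conic_at Q p := [/\ compact Q,
  forall u (t : R), 0 <= t <= 1 -> Q u -> Q (t *: u + (1 - t) *: p) &
  exists F, [/\ compact F, F `<=` Q, ~ F p & Q = cone_join p F]].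

Lemma convex_hull_conic A p : finite_set A -> A p ->
  ~ convex_hull (A `\ p) p -> conic_at (convex_hull A) p.
Proof.
move=> fA Ap nAp; split; first exact: convex_hull_compact.
  by move=> u t t01 Au; apply: convex_hull_convex => //; exact: sub_gen_smallest.
exists (convex_hull (A `\ p)); split=> //.
- by apply: convex_hull_compact; exact: finite_setD.
- by apply: sub_smallest2r; [apply/convex_set_combo; exact: convex_hull_convex|move=> ? []].
- by rewrite -convex_hull_setU1 setD1K.
Qed.

(* Rescaling the pair [u], [v] about [p] pushes one of the two points to a
   compact set disjoint from the other conic set. *)
Lemma conic_at_angle Q Q' p : conic_at Q p -> conic_at Q' p ->
  (forall z, Q z -> Q' z -> z = p) ->
  exists2 c : R, 0 < c &
    forall u v, Q u -> Q' v -> enorm (u - p) <= c * enorm (u - v).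
Proof.
move=> [cQ sQ [F [cF FQ nFp QE]]] [cQ' sQ' [F' [cF' FQ' nFp' QE']]] QQ'.
have [a a0 ha] : exists2 c : R, 0 < c & forall w v, F w -> Q' v -> c <= enorm (w - v).
  apply: compact_enorm_dist => //; rewrite -subset0 => z [Fz Qz]; apply: nFp.
  by rewrite -(QQ' z) //; exact: FQ.
have [b b0 hb] : exists2 c : R, 0 < c & forall w v, Q w -> F' v -> c <= enorm (w - v).
  apply: compact_enorm_dist => //; rewrite -subset0 => z [Qz Fz]; apply: nFp'.
  by rewrite -(QQ' z) //; exact: FQ'.
have [D D0 hD] := @compact_enorm_bounded R F [set p] cF (@compact_set1 _ p).
have Da0 : 0 < D / a by rewrite divr_gt0.
have Db0 : 0 < D / b by rewrite divr_gt0.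
exists (1 + D / a + D / b); first by rewrite !addr_gt0.
move=> u v Qu Q'v.
have big e : 0 <= e -> [\/ enorm (u - p) <= e, enorm (u - p) <= D / a * e |
    enorm (u - p) <= D / b * e] -> enorm (u - p) <= (1 + D / a + D / b) * e.
  by move=> e0 [] h; rewrite (le_trans h) // !mulrDl mul1r; nra.
apply: big; first exact: enorm_ge0.
have := Qu; rewrite QE => -[->|[t [w [/andP[t0 t1] Fw uE]]]].
  by apply: Or31; rewrite subrr enorm0 enorm_ge0.
have := Q'v; rewrite QE' => -[->|[s [w' [/andP[s0 s1] Fw' vE]]]].
  exact: Or31.
have up : u - p = t *: (w - p) by rewrite uE; apply/rowP => i; rewrite !mxE; ring.
have nup : enorm (u - p) <= D * t.
  by rewrite up enormZ ger0_norm // mulrC ler_wpM2r //; exact: hD.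
have [st|ts] := leP s t.
  have [t00|tn0] := eqVneq t 0.
    by apply: Or31; rewrite up t00 scale0r enorm0 enorm_ge0.
  have tp : 0 < t by rewrite lt_neqAle eq_sym tn0.
  apply: Or32; rewrite (le_trans nup) // -mulrA ler_wpM2l ?(ltW D0) //.
  rewrite mulrC ler_pdivlMr // mulrC.
  have -> : u - v = t *: (w - (s / t *: w' + (1 - s / t) *: p)).
    by rewrite uE vE; apply/rowP => i; rewrite !mxE; field.
  rewrite enormZ ger0_norm // mulrC ler_wpM2l //; apply: ha => //; apply: sQ'.
    by rewrite divr_ge0 //= ler_pdivrMr // mul1r.
  exact: FQ'.
have sp : 0 < s by exact: le_lt_trans ts.
apply: Or33; rewrite (le_trans nup) // -mulrA ler_wpM2l ?(ltW D0) //.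
rewrite mulrC ler_pdivlMr // mulrC.
have -> : u - v = s *: ((t / s *: w + (1 - t / s) *: p) - w').
  by rewrite uE vE; apply/rowP => i; rewrite !mxE; field; rewrite gt_eqF.
rewrite enormZ ger0_norm //; apply: (@le_trans _ _ (s * b)).
  by rewrite mulrC ler_wpM2r // ltW.
rewrite ler_wpM2l //; apply: hb => //; apply: sQ; last exact: FQ.
by rewrite divr_ge0 //= ler_pdivrMr // mul1r ltW.
Qed.

End ConvexHulls.

(** * Affine bijections and iteration of contractions *)

Section AffineMaps.
Variable R : realType.
Implicit Types (f g : 'rV[R]_2 -> 'rV[R]_2) (A B : set 'rV[R]_2).

Lemma enorm_lipschitz_continuous f L :
  (forall x y, enorm (f x - f y) <= L * enorm (x - y)) -> continuous f.
Proof.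
move=> fL x; apply/(@cvgrPdist_lt _ _ _ (nbhs x)) => e e0.
have M0 : 0 < `|L| * 2 + 1 by rewrite ltr_wpDl // mulr_ge0.
near=> y.
apply: (le_lt_trans (mxnorm_le_enorm _)); apply: (le_lt_trans (fL _ _)).
have xy : `|x - y| < e / (`|L| * 2 + 1).
  near: y; have := nbhsx_ballx x _ (divr_gt0 e0 M0).
  by apply: filterS => z; rewrite -ball_normE.
have := enorm_le_mxnorm (x - y); have := enorm_ge0 (x - y); have := ler_norm L.
move: xy; rewrite ltr_pdivlMr //; have := normr_ge0 (x - y).
by move: (enorm (x - y)) `|x - y| `|L| (normr_ge0 L) => E N a; nra.
Unshelve. all: by end_near. Qed.

Lemma affine_combo f : affine_map f -> forall x y (t : R),
  f (t *: x + (1 - t) *: y) = t *: f x + (1 - t) *: f y.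
Proof.
move=> [M [b fE]] x y t; rewrite !fE mulmxDl -!scalemxAl.
by apply/rowP => i; rewrite !mxE; ring.
Qed.

Lemma affine_lipschitz f : affine_map f ->
  exists2 L : R, 0 < L & forall x y, enorm (f x - f y) <= L * enorm (x - y).
Proof.
move=> [M [b fE]]; have [L L0 hL] := enorm_mulmx M; exists L => // x y.
by rewrite !fE opprD addrACA subrr addr0 -mulmxBl.
Qed.

Lemma affine_inverse f : affine_map f -> bijective f ->
  exists g, [/\ affine_map g, cancel f g & cancel g f].
Proof.
move=> [M [b fE]] [h fh hf].
(* [h] is only a set-theoretic inverse; the rows of the inverse matrix are its values at the
   translated basis vectors. *)
pose N := \matrix_(i < 2) h (delta_mx 0 i + b).
have NM : N *m M = 1%:M.
  apply/row_matrixP => i; rewrite row_mul rowK rowE mulmx1.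
  by apply: (addIr b); rewrite -fE hf.
have MN := mulmx1C NM.
exists (fun y => y *m N + - (b *m N)); split; first by exists N, (- (b *m N)).
  by move=> x; rewrite fE mulmxDl addrK -mulmxA MN mulmx1.
by move=> x; rewrite fE -mulmxBl -mulmxA NM mulmx1 subrK.
Qed.

Lemma conic_at_affine f Q p : affine_map f -> injective f ->
  conic_at Q p -> conic_at (f @` Q) (f p).
Proof.
move=> af fI [cQ sQ [F [cF FQ nFp QE]]].
have [L L0 fL] := affine_lipschitz af.
have cf A : compact A -> compact (f @` A).
  by apply: continuous_compact; apply: continuous_subspaceT;
     exact: (enorm_lipschitz_continuous fL).
split; first exact: cf.
  move=> _ t t01 [u Qu <-]; exists (t *: u + (1 - t) *: p); first exact: sQ.
  exact: affine_combo.
exists (f @` F); split; first exact: cf.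
- exact: image_subset.
- by move=> [z Fz /fI zp]; apply: nFp; rewrite -zp.
- rewrite QE; apply/seteqP; split.
    move=> _ [_ [->|[t [w [t01 Fw ->]]]] <-]; first by left.
    right; exists t, (f w); split=> //.
    exact: affine_combo.
  move=> _ [->|[t [_ [t01 [w Fw <-] ->]]]]; first by exists p => //; left.
  exists (t *: w + (1 - t) *: p); last exact: affine_combo.
  by right; exists t, w.
Qed.

(* Iterating [A <= U S_i A] and [S_i B <= B] brings the points of [A] within
   [q ^+ n * D] of [B]. *)
Lemma iterate_into_closed (m : nat) (S : 'I_m -> 'rV[R]_2 -> 'rV[R]_2) (q : R)
    A B : 0 <= q < 1 ->
  (forall i x y, enorm (S i x - S i y) <= q * enorm (x - y)) ->
  compact A -> compact B -> B !=set0 ->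
  A `<=` \bigcup_i (S i @` A) -> (forall i, S i @` B `<=` B) -> A `<=` B.
Proof.
move=> /andP[q0 q1] Sq cA cB [b0 Bb0] AS SB.
have [D D0 hD] := @compact_enorm_bounded R A B cA cB.
have near_B n : forall a, A a -> exists2 b, B b & enorm (a - b) <= q ^+ n * D.
  elim: n => [|n IHn] a Aa; first by exists b0 => //; rewrite mul1r; exact: hD.
  have [i _ [a' Aa' <-]] := AS _ Aa; have [b Bb h] := IHn _ Aa'.
  exists (S i b); first by apply: SB; exists b.
  by rewrite (le_trans (Sq _ _ _)) // exprS -mulrA ler_wpM2l.
move=> a Aa; apply: closed_enorm_adherent.
  by apply: compact_closed => //; exact: norm_hausdorff.
move=> e e0.
have [n _ hn] : \forall n \near \oo, q ^+ n * D < e.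
  have : (fun n => q ^+ n * D) @ \oo --> (0 * D : R).
    by apply: cvgMl; apply: cvg_expr; rewrite ger0_norm.
  by rewrite mul0r => /cvgr_lt; apply.
have [b Bb h] := near_B n _ Aa; exists b => //.
by rewrite (le_lt_trans h) // hn /=.
Qed.

End AffineMaps.

(** * A discrete winding number for functions continuous modulo 1 *)

Section Winding.
Variable R : realType.

Definition near_int (d : R) := exists z : int, `|d - z%:~R| < 1 / 4.

(** The representative of [d] modulo 1 in the interval from -1/2 (included) to 1/2 (excluded). *)
Definition wrap (d : R) : R := d - (Num.floor (d + 1 / 2))%:~R.

Lemma wrap_near d (z : int) : `|d - z%:~R| < 1 / 4 -> wrap d = d - z%:~R.
Proof.
rewrite /wrap ltr_norml => /andP[h1 h2]; congr (_ - _%:~R).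
by apply: floor_def; rewrite intrD; apply/andP; split; lra.
Qed.

Lemma wrap_int (z : int) : wrap z%:~R = 0.
Proof. by rewrite (wrap_near (z := z)) subrr // normr0; lra. Qed.

Lemma wrap_small d : `|d| < 1 / 4 -> wrap d = d.
Proof. by move=> h; rewrite (wrap_near (z := 0)) subr0. Qed.

(** Without [wrap] both sides agree, so they differ by an integer. Each of the four wrapped terms is
    below 1/4 in absolute value, so this integer is 0. *)
Lemma wrap_cell (a b c d : R) : near_int (b - a) -> near_int (d - c) ->
  near_int (c - a) -> near_int (d - b) ->
  wrap (d - c) - wrap (b - a) = wrap (d - b) - wrap (c - a).
Proof.
move=> [z1 h1] [z2 h2] [z3 h3] [z4 h4].
rewrite (wrap_near h1) (wrap_near h2) (wrap_near h3) (wrap_near h4).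
have : `|(z1 - z2 + z4 - z3)%:~R| < 1 :> R.
  rewrite !(intrD, intrN, rmorphB) /=.
  move: h1 h2 h3 h4; rewrite !ltr_norml => /andP[? ?] /andP[? ?] /andP[? ?] /andP[? ?].
  by apply/andP; split; lra.
rewrite -intr_norm -[1]/(1%:~R) ltr_int => h.
have : z1 - z2 + z4 - z3 = 0 by lia.
move=> /(congr1 (fun z : int => z%:~R : R)).
rewrite !(intrD, intrN, rmorphB) /=; lra.
Qed.

(** Discrete homotopy invariance. Passing from one row to the next changes the sum by a telescoping
    sum of vertical increments, whose two end terms vanish because the lateral sides are
    constant. *)
Lemma wrap_grid (G : nat -> nat -> R) (N : nat) :
  (forall k l, (k < N)%N -> (l <= N)%N -> near_int (G k.+1 l - G k l)) ->
  (forall k l, (k <= N)%N -> (l < N)%N -> near_int (G k l.+1 - G k l)) ->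
  (forall l, (l < N)%N -> G 0 l.+1 = G 0 l /\ G N l.+1 = G N l) ->
  \sum_(0 <= k < N) wrap (G k.+1 0 - G k 0) =
  \sum_(0 <= k < N) wrap (G k.+1 N - G k N).
Proof.
move=> hh hv side.
suff H l : (l <= N)%N -> \sum_(0 <= k < N) wrap (G k.+1 0 - G k 0) =
    \sum_(0 <= k < N) wrap (G k.+1 l - G k l) by exact: H.
elim: l => // l IHl lN; rewrite IHl ?(ltnW lN) //.
apply/eqP; rewrite eq_sym -subr_eq0 -sumrB.
rewrite (eq_big_nat _ _ (F2 := fun k => wrap (G k.+1 l.+1 - G k.+1 l) -
   wrap (G k l.+1 - G k l))); last first.
  by move=> k /andP[_ kN]; apply: wrap_cell; [apply: hh|apply: hh|apply: hv|apply: hv] => //; rewrite ltnW.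
rewrite (telescope_sumr (fun k => wrap (G k l.+1 - G k l))) //.
have [-> ->] := side _ lN.
by rewrite !subrr.
Qed.

Lemma uniform_continuity_square (H : R * R -> 'rV[R]_2) (e : R) :
  {within `[0, 1] `*` `[0, 1], continuous H} -> 0 < e ->
  exists2 d : R, 0 < d & forall s t s' t' : R, 0 <= s <= 1 -> 0 <= t <= 1 ->
    0 <= s' <= 1 -> 0 <= t' <= 1 -> `|s - s'| < d -> `|t - t'| < d ->
    enorm (H (s, t) - H (s', t')) < e.
Proof.
move=> cH e0; set Q := `[0, 1] `*` `[0, 1] in cH.
have cQ : compact Q by apply: compact_setX; exact: segment_compact.
have QP (s t : R) : 0 <= s <= 1 -> 0 <= t <= 1 -> Q (s, t).
  by move=> s01 t01; split; rewrite /= in_itv.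
have /near_covering_withinP cov := (compact_near_coveringP Q).1 cQ.
(* Two comparisons through the centre [z], each losing a factor 2 between the norms, add up to
   [e]. *)
have e4 : 0 < e / 4 by rewrite divr_gt0.
have hd : \forall d \near (0 : R)^'+, forall z, Q z -> forall y, Q y ->
    ball z d y -> enorm (H z - H y) < e.
  apply: cov => z Qz.
  have /(_ z Qz)/cvgrPdist_lt/(_ _ e4) := (subspace_continuousP _ H).1 cH.
  move=> /nbhs_ballP[r /= r0 hr].
  exists (ball z (r / 2), [set d : R | d < r / 2]).
    split => /=; first by apply: nbhsx_ballx; rewrite divr_gt0.
    by apply: nbhs_right_lt; rewrite divr_gt0.
  move=> [z' d] [/= zz' dr] Qz' y Qy z'y.
  have h1 : `|H z - H z'| < e / 4.
    by apply: hr => //; apply: le_ball zz'; rewrite ler_pdivrMr // ler_peMr ?ler1n // ltW.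
  have h2 : `|H z - H y| < e / 4.
    apply: hr => //; rewrite [r]splitr; apply: ball_triangle zz' _.
    by apply: (le_ball (ltW dr)).
  apply: (le_lt_trans (enormB_le _ (H z) _)); rewrite enormBC.
  have := enorm_le_mxnorm (H z - H z'); have := enorm_le_mxnorm (H z - H y).
  by move: h1 h2; lra.
near (0 : R)^'+ => d; exists d; first by near: d; exact: nbhs_right_gt.
have hQ : forall z, Q z -> forall y, Q y -> ball z d y -> enorm (H z - H y) < e.
  by near: d.
by move=> s t s' t' s01 t01 s'01 t'01 ss' tt'; apply: hQ; [exact: QP|exact: QP|].
Unshelve. all: by end_near. Qed.

End Winding.

(** * Loops in a simply connected set have winding number zero *)

Section Bypass.
Variable R : realType.

Lemma within_continuous_comp (T U W : topologicalType) (A : set T) (B : set U)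
    (f : U -> W) (h : T -> U) :
  {within B, continuous f} -> {within A, continuous h} ->
  (forall x, A x -> B (h x)) -> {within A, continuous (f \o h)}.
Proof.
move=> /subspace_continuousP cf /subspace_continuousP ch hAB.
apply/subspace_continuousP => x Ax.
apply: cvg_trans (cf _ (hAB _ Ax)) => V /= hV.
have := ch _ Ax _ hV; rewrite /= !nbhs_simpl /within /=.
apply: filterS => y /[swap] Ay; apply => //; exact: hAB.
Qed.

Lemma within_continuous_paste (a b c : R) (T : topologicalType) (f g : R -> T) :
  a <= b -> b <= c -> f b = g b ->
  {within `[a, b], continuous f} -> {within `[b, c], continuous g} ->
  {within `[a, c], continuous (fun t => if t <= b then f t else g t)}.
Proof.
move=> ab bc fg cf cg.
have -> : [set` `[a, c]] = [set` `[a, b]] `|` [set` `[b, c]].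
  apply/seteqP; split=> t /=; rewrite !in_itv /=.
    by move=> /andP[-> ->]; have [|/ltW] := leP t b; [left|right; rewrite andbT].
  by case=> /andP[h1 h2]; apply/andP; split=> //; [exact: le_trans bc|exact: le_trans h1].
apply: withinU_continuous; try exact: itv_closed.
- apply: subspace_eq_continuous cf => t; rewrite inE /= in_itv /= => /andP[_ tb] /=.
  by rewrite /from_subspace /= tb.
- apply: subspace_eq_continuous cg => t; rewrite inE /= in_itv /= => /andP[bt _].
  rewrite /from_subspace /=; case: ifPn => // tb; have -> : t = b by apply/le_anti; rewrite tb bt.
  exact/esym.
Qed.

(** A null-homotopy sampled on a fine grid satisfies [wrap_grid], and its last row is constant. Only
    increments of [g] modulo 1 are controlled, so [g] itself may jump by integers. *)
Lemma winding_null (X : set 'rV[R]_2) (g : 'rV[R]_2 -> R) (e : R)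
    (f : R -> 'rV[R]_2) : simply_connected X -> 0 < e ->
  (forall u v, X u -> X v -> enorm (u - v) < e -> near_int (g u - g v)) ->
  {within `[0, 1], continuous f} -> f @` `[0, 1] `<=` X -> f 0 = f 1 ->
  exists2 d : R, 0 < d & forall N, (0 < N)%N -> N%:R^-1 < d ->
    \sum_(0 <= k < N) wrap (g (f (k.+1%:R / N%:R)) - g (f (k%:R / N%:R))) = 0.
Proof.
move=> [_ sc] e0 hg cf fX f01.
have [H [cH HX Hbot Hside]] := sc f cf fX f01.
have [d d0 hd] := uniform_continuity_square cH e0.
exists d => // N N0 Nd.
have NR0 : 0 < N%:R :> R by rewrite ltr0n.
have itv k : (k <= N)%N -> 0 <= (k%:R : R) / N%:R <= 1.
  by move=> kN; apply/andP; split; [rewrite divr_ge0|rewrite ler_pdivrMr // mul1r ler_nat].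
have XH k l : (k <= N)%N -> (l <= N)%N -> X (H (k%:R / N%:R, l%:R / N%:R)).
  move=> kN lN; apply: HX; exists (k%:R / N%:R, l%:R / N%:R) => //.
  by split; rewrite /= in_itv /= itv.
have step k : `|(k.+1%:R : R) / N%:R - k%:R / N%:R| < d.
  by rewrite -mulrBl -natrB // subSnn mul1r ger0_norm // ltW // invr_gt0.
have stay (t : R) : `|t - t| < d by rewrite subrr normr0.
have := @wrap_grid R (fun k l => g (H (k%:R / N%:R, l%:R / N%:R))) N.
have NN : N%:R / N%:R = 1 :> R by rewrite divff // gt_eqF.
rewrite /= mul0r NN => grid.
rewrite (eq_big_nat _ _ (F2 := fun k => wrap (g (H (k.+1%:R / N%:R, 0)) -
    g (H (k%:R / N%:R, 0))))); last first.
  move=> k /andP[_ kN].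
  by have [-> _] := Hbot _ (itv k.+1 kN); have [-> _] := Hbot _ (itv k (ltnW kN)).
rewrite grid.
- rewrite big_nat big1 // => k /andP[_ kN].
  have [_ ->] := Hbot _ (itv k.+1 kN); have [_ ->] := Hbot _ (itv k (ltnW kN)).
  by rewrite subrr -[0]/(0%:~R) wrap_int.
- move=> k l kN lN; apply: hg; [exact: XH|apply: XH => //; exact: ltnW|].
  by apply: hd; rewrite ?itv // ltnW.
- move=> k l kN lN; apply: hg; [exact: XH|apply: XH => //; exact: ltnW|].
  by apply: hd; rewrite ?itv // ltnW.
- move=> l lN; have [-> ->] := Hside _ (itv l.+1 lN).
  by have [-> ->] := Hside _ (itv l (ltnW lN)).
Qed.

(* Closing [f] up by the segment from [f 1] to [f 0] inside [Q] gives a loop of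
   winding number one for [g] modulo 1. *)
Lemma no_bypass (X Q : set 'rV[R]_2) (g : 'rV[R]_2 -> R) (e : R)
    (f : R -> 'rV[R]_2) : simply_connected X -> Q `<=` X -> 0 < e ->
  (forall u v t, 0 <= t <= 1 -> Q u -> Q v -> Q (t *: u + (1 - t) *: v)) ->
  (forall u v, X u -> X v -> enorm (u - v) < e -> near_int (g u - g v)) ->
  (forall u v, Q u -> Q v -> enorm (u - v) < e -> `|g u - g v| < 1 / 4) ->
  (forall u, X u -> ~ Q u -> g u = 0) ->
  {within `[0, 1], continuous f} -> f @` `[0, 1] `<=` X ->
  Q (f 0) -> Q (f 1) -> (forall t, 0 < t < 1 -> ~ Q (f t)) ->
  g (f 0) = 1 -> g (f 1) = 0 -> False.
Proof.
move=> sc QX e0 cQ gX gQ g0 cf fX Qf0 Qf1 fQ gf0 gf1.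
(* The loop runs along [f] up to time 1/2, then back from [f 1] to [f 0] on a straight segment. *)
pose seg (s : R) := (2 * s - 1) *: f 0 + (1 - (2 * s - 1)) *: f 1.
pose F (s : R) := if s <= 1 / 2 then f (2 * s) else seg s.
have Fl (s : R) : s <= 1 / 2 -> F s = f (2 * s) by rewrite /F => ->.
have Fr (s : R) : 1 / 2 <= s -> F s = seg s.
  move=> hs; rewrite /F; case: ifPn => // hs'.
  have -> : s = 1 / 2 by apply/le_anti; rewrite hs hs'.
  have h2 : 2 * (1 / 2) = 1 :> R by field.
  by rewrite /seg h2 subrr scale0r add0r subr0 scale1r.
have Qseg (s : R) : 1 / 2 <= s <= 1 -> Q (seg s).
  by move=> /andP[? ?]; apply: cQ => //; apply/andP; split; lra.
have cF : {within `[0, 1], continuous F}.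
  apply: within_continuous_paste; [lra|lra| | |].
  - by rewrite -Fl ?Fr.
  - apply: within_continuous_comp cf _ _.
      by apply: continuous_subspaceT => x; apply: cvgMr; exact: cvg_id.
    by move=> x /=; rewrite !in_itv /= => /andP[? ?]; apply/andP; split; lra.
  - apply: continuous_subspaceT => x.
    have c1 : (fun s : R => 2 * s - 1) @ x --> 2 * x - 1.
      by apply: cvgB; [apply: cvgMr; exact: cvg_id|exact: cvg_cst].
    apply: cvgD; apply: cvgZr_tmp => //.
    by apply: cvgB => //; exact: cvg_cst.
have FX : F @` `[0, 1] `<=` X.
  move=> _ [s /= + <-]; rewrite in_itv /= => /andP[s0 s1].
  have [hs|hs] := leP s (1 / 2).
    by rewrite Fl //; apply: fX; exists (2 * s) => //=; rewrite in_itv /=; apply/andP; split; lra.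
  by rewrite Fr ?ltW //; apply: QX; apply: Qseg; rewrite ltW.
have F01 : F 0 = F 1.
  rewrite Fl; last lra.
  rewrite Fr /seg; last lra.
  have -> : 2 * 1 - 1 = 1 :> R by ring.
  by rewrite mulr0 subrr scale0r addr0 scale1r.
have [d d0 hd] := winding_null sc e0 gX cF FX F01.
pose D := enorm (f 0 - f 1).
have D0 : 0 <= D := enorm_ge0 _.
(* With [n + n] samples the junction at time 1/2 is a sample point. The term [d^-1] makes the mesh
   finer than [d]; [D / e] makes consecutive samples on the segment closer than [e]. *)
have [n hn] : exists n : nat, d^-1 + D / e + 1 < n%:R.
  exists (Num.truncn (d^-1 + D / e + 1)).+1; exact: truncnS_gt.
have di0 : 0 < d^-1 by rewrite invr_gt0.
have De0 : 0 <= D / e by rewrite divr_ge0 // ltW.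
have n0R : 0 < n%:R :> R by lra.
have n0 : (0 < n)%N by rewrite -(ltr0n R).
have nn0 : (0 < n + n)%N by rewrite addn_gt0 n0.
have nnE : (n + n)%:R = 2 * n%:R :> R by rewrite natrD; ring.
have := hd _ nn0; rewrite nnE.
have -> : (2 * n%:R)^-1 < d.
  by rewrite invf_plt ?posrE //; [lra|rewrite mulr_gt0].
move=> /(_ isT).
rewrite (big_cat_nat (n := n)) //= ?leq_addr //.
have val k : (k <= n)%N -> 2 * (k%:R / (2 * n%:R)) = k%:R / n%:R :> R.
  by move=> _; field; rewrite gt_eqF.
have lowE k : (k <= n)%N -> F (k%:R / (2 * n%:R)) = f (k%:R / n%:R).
  move=> kn; rewrite Fl ?val //.
  rewrite ler_pdivrMr ?mulr_gt0 //.
  have -> : 1 / 2 * (2 * n%:R) = n%:R :> R by field.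
  by rewrite ler_nat.
(* On the first half [g] takes only the integer values 1 and 0, so all wrapped increments vanish
   there. *)
have glow k : (k <= n)%N -> g (F (k%:R / (2 * n%:R))) = (k == 0%N)%:R.
  move=> kn; rewrite lowE //; case: eqP => [->|k0]; first by rewrite mul0r.
  have [->|kn'] := eqVneq k n; first by rewrite divff ?gt_eqF.
  have ltkn : (k < n)%N by rewrite ltn_neqAle kn' kn.
  have h01 : 0 < (k%:R : R) / n%:R < 1.
    by apply/andP; split; [rewrite divr_gt0 // ltr0n lt0n; exact/eqP|rewrite ltr_pdivrMr // mul1r ltr_nat].
  apply: g0; last exact: fQ.
  by apply: fX; exists (k%:R / n%:R) => //=; rewrite in_itv /=; case/andP: h01 => /ltW -> /ltW ->.
rewrite big_nat big1 ?add0r; last first.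
  move=> k /andP[_ kn]; rewrite !glow // ?(ltnW kn) //=.
  have -> : 0 - (k == 0%N)%:R = (- (k == 0%N)%:Z)%:~R :> R by rewrite rmorphN sub0r.
  exact: wrap_int.
have Fhi (k : nat) : (n <= k)%N -> 1 / 2 <= k%:R / (2 * n%:R) :> R.
  move=> nk; rewrite ler_pdivlMr ?mulr_gt0 //.
  have -> : 1 / 2 * (2 * n%:R) = n%:R :> R by field.
  by rewrite ler_nat.
have Fle (k : nat) : (k <= n + n)%N -> k%:R / (2 * n%:R) <= 1 :> R.
  by move=> nk; rewrite ler_pdivrMr ?mulr_gt0 // mul1r -nnE ler_nat.
(* On the second half the increments are too small to be changed by [wrap]; they telescope to
   [g (f 0) - g (f 1) = 1], against a total of 0. *)
rewrite (eq_big_nat _ _ (F2 := fun k => g (F (k.+1%:R / (2 * n%:R))) -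
   g (F (k%:R / (2 * n%:R))))); last first.
  move=> k /andP[nk knn]; apply: wrap_small.
  have nk1 : (n <= k.+1)%N by rewrite ltnW.
  apply: gQ.
  - by rewrite Fr ?Fhi //; apply: Qseg; rewrite Fhi // Fle.
  - by rewrite Fr ?Fhi //; apply: Qseg; rewrite Fhi // Fle // ltnW.
  rewrite !Fr ?Fhi //.
  have -> : seg (k.+1%:R / (2 * n%:R)) - seg (k%:R / (2 * n%:R)) =
      n%:R^-1 *: (f 0 - f 1).
    rewrite /seg; apply/rowP => i; rewrite !mxE -natr1; field.
    by rewrite gt_eqF.
  rewrite enormZ ger0_norm ?invr_ge0 ?(ltW n0R) // mulrC ltr_pdivrMr //.
  have : D / e < n%:R by lra.
  by rewrite ltr_pdivrMr // mulrC.
rewrite telescope_sumr ?leq_addr // nnE divff ?gt_eqF ?mulr_gt0 // -F01 Fl; last lra.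
rewrite mulr0 gf0 glow // eqn0Ngt n0 => /eqP.
by rewrite subr0 oner_eq0.
Qed.

End Bypass.

(** * First and last visits of a path to a closed set *)

Section HittingTimes.
Variable R : realType.
Implicit Types (f : R -> 'rV[R]_2) (A : set 'rV[R]_2).

Lemma last_hitting_time f A (a b : R) : a <= b -> closed A ->
  {within `[a, b], continuous f} -> A (f a) ->
  exists c, [/\ a <= c <= b, A (f c) & forall t, c < t <= b -> ~ A (f t)].
Proof.
move=> ab cA /subspace_continuousP cf Aa.
pose E := [set t | a <= t <= b /\ A (f t)].
have Ea : E a by split=> //; rewrite lexx.
have supE : has_sup E.
  by split; [exists a|exists b => t [/andP[_ tb] _]].
have Ec t : E t -> t <= sup E by move=> Et; exact: (sup_upper_bound supE).
have cab : a <= sup E <= b.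
  by rewrite Ec //= ge_sup //; [exists a|move=> t [/andP[_ tb] _]].
exists (sup E); split=> //; last first.
  move=> t /andP[ct tb] At; have := ct; rewrite ltNge => /negP; apply; apply: (Ec).
  by split=> //; rewrite tb andbT (le_trans (Ec _ Ea)) // ltW.
apply: closed_enorm_adherent => // e e0.
have e2 : 0 < e / 2 by rewrite divr_gt0.
have cab' : `[a, b]%classic (sup E) by rewrite /= in_itv.
have /cvgrPdist_lt/(_ _ e2) := cf _ cab'.
move=> /nbhs_ballP[r /= r0 hr].
have [t [tab At] rt] := sup_adherent r0 supE.
exists (f t) => //; apply: (le_lt_trans (enorm_le_mxnorm _)).
rewrite mulrC -ltr_pdivlMr //; apply: hr; last by rewrite /= in_itv.
rewrite -ball_normE /= ger0_norm ?subr_ge0 ?Ec //; lra.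
Qed.

(** Time reversal of [last_hitting_time]. *)
Lemma first_hitting_time f A (a b : R) : a <= b -> closed A ->
  {within `[a, b], continuous f} -> A (f b) ->
  exists c, [/\ a <= c <= b, A (f c) & forall t, a <= t < c -> ~ A (f t)].
Proof.
move=> ab cA cf Ab.
have cf' : {within `[- b, - a], continuous (f \o -%R)}.
  apply: within_continuous_comp cf _ _.
    by apply: continuous_subspaceT => x; exact: opp_continuous.
  by move=> x /=; rewrite !in_itv /= => /andP[? ?]; apply/andP; split; lra.
have := last_hitting_time _ cA cf'; rewrite lerN2 /= opprK => /(_ ab Ab).
move=> [c [/andP[bc ca] Ac hc]]; exists (- c); split=> //.
  by apply/andP; split; lra.
move=> t /andP[at_ tc]; rewrite -(opprK t); apply: hc.
by apply/andP; split; lra.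
Qed.

Lemma within_continuous_rescale f (a b : R) : a <= b ->
  {within `[a, b], continuous f} ->
  {within `[0, 1], continuous (fun s => f (a + (b - a) * s))}.
Proof.
move=> ab cf; apply: (@within_continuous_comp _ _ _ _ _ f) cf _ _.
  apply: continuous_subspaceT => x; apply: cvgD; first exact: cvg_cst.
  by apply: cvgMr; exact: cvg_id.
by move=> x /=; rewrite !in_itv /= => /andP[? ?]; apply/andP; split; nra.
Qed.

End HittingTimes.

(** The property survives shrinking the constant, so a finite minimum serves all indices; its seed 1
    covers an empty index type. *)
Lemma uniform_pos (R : realType) (I : finType) (P : I -> R -> Prop) :
  (forall i c c', 0 < c' -> c' <= c -> P i c -> P i c') ->
  (forall i, exists2 c, 0 < c & P i c) -> exists2 c, 0 < c & forall i, P i c.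
Proof.
move=> mono /(_ _)/cid2 ex.
exists (\big[Num.min/1]_i s2val (ex i)).
  by elim/big_ind: _ => // [x y x0 y0|i _]; [rewrite lt_min x0|exact: (s2valP (ex i))].
move=> i; apply: mono (s2valP' (ex i)).
  by elim/big_ind: _ => // [x y x0 y0|j _]; [rewrite lt_min x0|exact: (s2valP (ex j))].
exact: bigmin_le_cond.
Qed.

(** * Convex pieces meeting in single points, with simply connected union *)

Section TouchingFamily.
Variables (R : realType) (m : nat) (Q W : 'I_m -> set 'rV[R]_2).

(** What the topological argument retains of the system: [Q i] stands for the polygon [S i @] P and
    [W i] for its vertices, which contain all contact points. *)
Record touching_family : Prop := {
  tf_compact : forall i, compact (Q i);
  tf_convex : forall i u v (t : R), 0 <= t <= 1 -> Q i u -> Q i v ->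
    Q i (t *: u + (1 - t) *: v);
  tf_finite : forall i, finite_set (W i);
  tf_touch : forall i k z, i != k -> Q i z -> Q k z -> W i z;
  tf_uniq : forall i k, i != k -> is_subset1 (Q i `&` Q k);
  tf_conic : forall i z, W i z -> conic_at (Q i) z;
  tf_simply_connected : simply_connected (\bigcup_i Q i)
}.

Hypothesis tfQ : touching_family.

Lemma touching_separation : exists2 c : R, 0 < c &
  forall i k u v, i != k -> Q i u -> Q k v -> c <= enorm (u - v) \/
    exists p, [/\ Q i p, Q k p, c * enorm (u - p) <= enorm (u - v)
      & c * enorm (v - p) <= enorm (u - v)].
Proof.
(* Ordered pairs become a single finite index, so that [uniform_pos] gives one constant for all of
   them. *)
suff [c c0 hc] : exists2 c : R, 0 < c &
    forall ik : 'I_m * 'I_m, forall u v, ik.1 != ik.2 -> Q ik.1 u -> Q ik.2 v ->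
    c <= enorm (u - v) \/
    exists p, [/\ Q ik.1 p, Q ik.2 p, c * enorm (u - p) <= enorm (u - v)
      & c * enorm (v - p) <= enorm (u - v)].
  by exists c => // i k u v; exact: (hc (i, k)).
apply: uniform_pos.
  move=> [i k] c c' c'0 cc' h u v ik Qu Qv; have [h1|[p [Qp Qp' h1 h2]]] := h u v ik Qu Qv.
    by left; exact: le_trans h1.
  right; exists p; split=> //.
    by apply: le_trans h1; rewrite ler_wpM2r // enorm_ge0.
  by apply: le_trans h2; rewrite ler_wpM2r // enorm_ge0.
move=> [i k] /=; have [ik|ik] := eqVneq i k; first by exists 1.
have [[p [Qp Q'p]]|disj] := pselect (Q i `&` Q k !=set0); last first.
  have [|c c0 hc] := compact_enorm_dist (@tf_compact tfQ i) (@tf_compact tfQ k).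
    by rewrite -subset0 => z Qz; apply: disj; exists z.
  by exists c => // u v _ Qu Qv; left; exact: hc.
have ki : k != i by rewrite eq_sym.
have zp z : Q i z -> Q k z -> z = p.
  by move=> Qz Qz'; apply: (tf_uniq tfQ ik); split.
have ci := tf_conic tfQ (tf_touch tfQ ik Qp Q'p).
have ck := tf_conic tfQ (tf_touch tfQ ki Q'p Qp).
have [c c0 hc] := conic_at_angle ci ck zp.
have [d d0 hd] := conic_at_angle ck ci (fun z h h' => zp z h' h).
(* The angle constant [c] controls the distance from [u] to [p] and [d] the one from [v] to [p];
   their sum serves both. *)
exists ((c + d)^-1); first by rewrite invr_gt0 addr_gt0.
have cd0 : 0 < c + d by rewrite addr_gt0.
move=> u v _ Qu Qv; right; exists p; split=> //; rewrite mulrC ler_pdivrMr // mulrC.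
  by apply: le_trans (hc _ _ Qu Qv) _; rewrite ler_wpM2r ?enorm_ge0 // lerDl ltW.
rewrite (enormBC u); apply: le_trans (hd _ _ Qv Qu) _.
by rewrite ler_wpM2r ?enorm_ge0 // lerDr ltW.
Qed.

(** A bump of height 1 and radius [d] at [p], cut off to 0 outside [Q i]. The cut is invisible
    modulo 1 when the bump is integral at the contact points. *)
Let tent (i : 'I_m) p (d : R) u : R :=
  if `[< Q i u >] then Num.max 0 (1 - enorm (u - p) / d) else 0.

Let tentE i p d u : Q i u -> tent i p d u = Num.max 0 (1 - enorm (u - p) / d).
Proof. by move=> Qu; rewrite /tent; case: asboolP. Qed.

Let tent0 i p d u : ~ Q i u -> tent i p d u = 0.
Proof. by move=> Qu; rewrite /tent; case: asboolP. Qed.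

Let tent_lipschitz i p d u v : 0 < d -> Q i u -> Q i v ->
  `|tent i p d u - tent i p d v| <= enorm (u - v) / d.
Proof.
move=> d0 Qu Qv; rewrite !tentE //.
have h (a b : R) : `|Num.max 0 a - Num.max 0 b| <= `|a - b|.
  have h1 : a - b <= `|a - b| := ler_norm _.
  have h2 : b - a <= `|a - b| by rewrite distrC; exact: ler_norm.
  move: `|a - b| h1 h2 => n h1 h2.
  have [a0|a0] := leP 0 a; have [b0|b0] := leP 0 b;
    rewrite ?(max_r a0) ?(max_r b0) ?(max_l (ltW a0)) ?(max_l (ltW b0)) ler_norml;
    apply/andP; split; lra.
apply: (le_trans (h _ _)).
rewrite opprB addrC subrKA -mulrBl normrM [X in _ * X]gtr0_norm ?invr_gt0 //.
rewrite ler_wpM2r ?invr_ge0 ?(ltW d0) // ler_norml; apply/andP; split.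
  by have := enormB_le u v p; lra.
by have := enormB_le v u p; rewrite (enormBC v u); lra.
Qed.

(** If the end points differed, the tent at [f 0] would be 1 there and 0 at [f 1], and [no_bypass]
    would apply to it. *)
Lemma no_excursion i (f : R -> 'rV[R]_2) :
  {within `[0, 1], continuous f} -> f @` `[0, 1] `<=` \bigcup_i Q i ->
  Q i (f 0) -> Q i (f 1) -> (forall t, 0 < t < 1 -> ~ Q i (f t)) -> f 0 = f 1.
Proof.
move=> cf fX Q0 Q1 fQ; apply: contrapT => f01.
have [c c0 sep] := touching_separation.
(* The radius is chosen so that the tent vanishes at [f 1] and at every vertex other than [f 0]. *)
have [d d0 hd] : exists2 d : R, 0 < d & forall z, (W i z \/ z = f 1) -> z <> f 0 ->
    d <= enorm (z - f 0).
  have cA : compact ((W i `|` [set f 1]) `\ f 0).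
    apply: finite_compact; apply: finite_setD; rewrite finite_setU; split.
      exact: tf_finite.
    exact: finite_set1.
  have [|d d0 h] := compact_enorm_dist cA (@compact_set1 _ (f 0)).
    by rewrite -subset0 => z [[_ nz] /nz].
  by exists d => // z Wz zf; apply: h.
have tent_int z : W i z \/ z = f 1 -> exists k : int, tent i (f 0) d z = k%:~R.
  move=> Wz; have [Qz|nQz] := pselect (Q i z); last by exists 0; rewrite tent0.
  rewrite tentE //; have [->|/eqP zf] := eqVneq z (f 0).
    by exists 1; rewrite subrr enorm0 mul0r subr0 max_r.
  exists 0; rewrite max_l // subr_le0 ler_pdivlMr // mul1r; exact: hd.
(* Closeness below [c] forces a common point of the two pieces; [d / 4] bounds the variation of the
   tent between nearby points of [Q i]; [c * d / 4] bounds it between a point and that common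
   point. *)
pose e := Num.min (Num.min c (d / 4)) (c * d / 4).
have e0 : 0 < e by rewrite !lt_min c0 !divr_gt0 ?mulr_gt0.
have small u v : enorm (u - v) < e ->
    [/\ enorm (u - v) < c, enorm (u - v) / d < 1 / 4 & enorm (u - v) / (c * d) < 1 / 4].
  rewrite !lt_min => /andP[/andP[h1 h2] h3]; split=> //.
    by rewrite ltr_pdivrMr //; lra.
  by rewrite ltr_pdivrMr ?mulr_gt0 //; lra.
have half u v : Q i u -> (\bigcup_i Q i) v -> ~ Q i v -> enorm (u - v) < e ->
    exists k : int, `|tent i (f 0) d u - k%:~R| < 1 / 4.
  move=> Qu [k _ Qv] nQv /small[h1 h2 h3].
  have ik : i != k by apply/eqP => ik; apply: nQv; rewrite ik.
  have [|[p [Qp Q'p up _]]] := sep _ _ _ _ ik Qu Qv; first by rewrite leNgt h1.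
  have [z hz] := tent_int p (or_introl (tf_touch tfQ ik Qp Q'p)).
  exists z; rewrite -hz; apply: le_lt_trans h3; apply: le_trans (tent_lipschitz _ d0 Qu Qp) _.
  rewrite invfM mulrA ler_wpM2r ?invr_ge0 ?(ltW d0) //.
  by rewrite ler_pdivlMr // mulrC.
apply: (@no_bypass R (\bigcup_i Q i) (Q i) (tent i (f 0) d) e f) => //.
- exact: tf_simply_connected.
- by move=> u Qu; exists i.
- exact: tf_convex.
- move=> u v Xu Xv uv.
  have [Qu|nQu] := pselect (Q i u); have [Qv|nQv] := pselect (Q i v).
  + exists 0; rewrite subr0; apply: le_lt_trans (tent_lipschitz _ d0 Qu Qv) _.
    by case: (small _ _ uv).
  + have [k hk] := half _ _ Qu Xv nQv uv.
    by exists k; rewrite (tent0 _ _ nQv) subr0.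
  + rewrite enormBC in uv; have [k hk] := half _ _ Qv Xu nQu uv.
    by exists (- k); rewrite (tent0 _ _ nQu) sub0r intrN -opprB normrN opprK addrC.
  + by exists 0; rewrite !tent0 // !subr0 normr0; lra.
- move=> u v Qu Qv uv; apply: le_lt_trans (tent_lipschitz _ d0 Qu Qv) _.
  by case: (small _ _ uv).
- by move=> u _; exact: tent0.
- by rewrite tentE // subrr enorm0 mul0r subr0 max_r.
- rewrite tentE // max_l // subr_le0 ler_pdivlMr // mul1r; apply: hd; first by right.
  by move=> h; apply: f01.
Qed.

(** Around a time spent outside [Q i], the last exit and the next return bound an excursion. Its end
    points coincide by [no_excursion], against injectivity. *)
Lemma arc_inside i (f : R -> 'rV[R]_2) (a b : R) :
  {within `[a, b], continuous f} -> set_inj `[a, b] f ->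
  f @` `[a, b] `<=` \bigcup_i Q i -> Q i (f a) -> Q i (f b) ->
  forall t, a <= t <= b -> Q i (f t).
Proof.
move=> cf fI fX Qa Qb t /andP[at_ tb]; apply: contrapT => nQt.
have clQ : closed (Q i) by apply: compact_closed (@tf_compact tfQ i); exact: norm_hausdorff.
have cl : {within `[a, t], continuous f}.
  by apply: continuous_subspaceW cf; apply: subset_itvl; rewrite bnd_simp.
have cr : {within `[t, b], continuous f}.
  by apply: continuous_subspaceW cf; apply: subset_itvr; rewrite bnd_simp.
have [c [/andP[ac ct] Qc hc]] := last_hitting_time at_ clQ cl Qa.
have [d [/andP[td db] Qd hd]] := first_hitting_time tb clQ cr Qb.
have nct : c != t by apply/eqP => ct'; apply: nQt; rewrite -ct'.
have ntd : t != d by apply/eqP => td'; apply: nQt; rewrite td'.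
have {}ct : c < t by rewrite lt_neqAle nct.
have {}td : t < d by rewrite lt_neqAle ntd.
have cd : c < d by exact: lt_trans td.
have cfcd : {within `[c, d], continuous f}.
  by apply: continuous_subspaceW cf; apply: subset_itv; rewrite bnd_simp.
have := @no_excursion i _ (within_continuous_rescale (ltW cd) cfcd).
rewrite mulr0 addr0 mulr1 subrKC => /(_ _ Qc Qd) h.
have fcd : f c = f d.
  apply: h.
    move=> _ [s /= + <-]; rewrite in_itv /= => /andP[s0 s1]; apply: fX.
    by exists (c + (d - c) * s) => //=; rewrite in_itv /=; apply/andP; split; nra.
  move=> s /andP[s0 s1]; have [st|ts] := leP (c + (d - c) * s) t.
    by apply: hc; rewrite st andbT ltrDl mulr_gt0 // subr_gt0.
  by apply: hd; apply/andP; split; [exact: ltW|nra].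
have : c = d.
  apply: fI fcd; rewrite inE /= in_itv /=; apply/andP; split=> //; lra.
by move=> cd'; rewrite cd' ltxx in cd.
Qed.

(* An arc missing the common point could be prolonged inside [Q k] into a
   forbidden excursion out of [Q i]. *)
Lemma arc_through i k p (f : R -> 'rV[R]_2) (a b : R) : a <= b ->
  {within `[a, b], continuous f} -> f @` `[a, b] `<=` \bigcup_i Q i ->
  i != k -> Q i (f a) -> Q k (f b) -> Q i p -> Q k p ->
  exists2 c, a <= c <= b & f c = p.
Proof.
move=> ab cf fX ik Qa Qb Qp Q'p.
have zp z : Q i z -> Q k z -> z = p.
  by move=> Qz Qz'; apply: (tf_uniq tfQ ik); split.
have clQ j : closed (Q j) by apply: compact_closed (@tf_compact tfQ j); exact: norm_hausdorff.
have [c [/andP[ac cb] Qc hc]] := last_hitting_time ab (clQ i) cf Qa.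
have cr : {within `[c, b], continuous f}.
  by apply: continuous_subspaceW cf; apply: subset_itvr; rewrite bnd_simp.
have [d [/andP[cd db] Qd hd]] := first_hitting_time cb (clQ k) cr Qb.
have [fdp|fdp] := pselect (f d = p); first by exists d; rewrite // db (le_trans ac).
have {}cd : c < d.
  rewrite lt_neqAle cd andbT; apply/eqP => cd'; apply: fdp; apply: zp => //.
  by rewrite -cd'.
(* Here the exit point [f c] is itself shown to be [p]: the piece of [f] on [[c, d]], prolonged by
   the segment from [f d] to [p] in [Q k], meets [Q i] only at its ends. *)
exists c; first by rewrite ac cb.
have cfcd : {within `[c, d], continuous f}.
  by apply: continuous_subspaceW cf; apply: subset_itv; rewrite bnd_simp.
pose l (s : R) := f (c + (d - c) * (2 * s)).
pose r (s : R) := (2 * s - 1) *: p + (1 - (2 * s - 1)) *: f d.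
pose F (s : R) := if s <= 1 / 2 then l s else r s.
have F0 : F 0 = f c.
  by rewrite /F /l ifT ?mulr0 ?addr0 //; lra.
have F1 : F 1 = p.
  rewrite /F ifF; last by apply/negbTE; rewrite -ltNge; lra.
  have h : 2 * 1 - 1 = 1 :> R by ring.
  by rewrite /r h subrr scale0r addr0 scale1r.
rewrite -F0 -[RHS]F1; apply: (@no_excursion i F).
- apply: within_continuous_paste; [lra|lra| | |].
  + have h : 2 * (1 / 2) = 1 :> R by field.
    by rewrite /l /r h subrr scale0r add0r subr0 scale1r mulr1 subrKC.
  + apply: within_continuous_comp (within_continuous_rescale (ltW cd) cfcd) _ _.
      by apply: continuous_subspaceT => x; apply: cvgMr; exact: cvg_id.
    by move=> x /=; rewrite !in_itv /= => /andP[? ?]; apply/andP; split; lra.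
  + apply: continuous_subspaceT => x.
    have c1 : (fun s : R => 2 * s - 1) @ x --> 2 * x - 1.
      by apply: cvgB; [apply: cvgMr; exact: cvg_id|exact: cvg_cst].
    apply: cvgD; apply: cvgZr_tmp => //.
    by apply: cvgB => //; exact: cvg_cst.
- move=> _ [s /= + <-]; rewrite in_itv /= => /andP[s0 s1]; rewrite /F.
  case: leP => hs.
    apply: fX; exists (c + (d - c) * (2 * s)) => //=; rewrite in_itv /=.
    by apply/andP; split; nra.
  by exists k => //; apply: (tf_convex tfQ) => //; apply/andP; split; lra.
- by rewrite F0.
- by rewrite F1.
move=> s /andP[s0 s1]; rewrite /F; case: leP => hs.
  by apply: hc; apply/andP; split; nra.
(* A point of the segment lying in [Q i] would be the common point [p]; before time 1 this is
   possible only if [f d = p]. *)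
move=> Qr; apply: fdp.
have Q'r : Q k (r s) by apply: (tf_convex tfQ) => //; apply/andP; split; lra.
have : (2 - 2 * s) *: (f d - p) = 0.
  have <- : r s - p = 0 by rewrite (zp _ Qr Q'r) subrr.
  by rewrite /r; apply/rowP => j; rewrite !mxE; ring.
move=> /eqP; rewrite scaler_eq0 => /orP[/eqP h|].
  by move: s1; rewrite ltNge -(ler_pM2l (ltr0n _ 2)) mulr1 -subr_le0 h lexx.
by rewrite subr_eq0 => /eqP.
Qed.

End TouchingFamily.

(** * The polygonal system: uniform ratios, vertices and pull-back of arcs *)

Section HolderArcs.
Variables (R : realType) (P V : set 'rV[R]_2) (m : nat).
Variables (S : 'I_m -> 'rV[R]_2 -> 'rV[R]_2) (K : set 'rV[R]_2).
Hypotheses (hP : convex_polygon P V) (hS : sc_polygonal_system P V S).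
Hypothesis hK : attractor S K.

Let Q i := S i @` P.

Let P_compact : compact P.
Proof. by case: hP => fV -> _ _; exact: convex_hull_compact. Qed.

Let VP : V `<=` P.
Proof. by case: hP => _ -> _ _; exact: sub_gen_smallest. Qed.

Let S_inj i : injective (S i).
Proof. exact: bij_inj (sys_invertible hS i). Qed.

Let S_compact i A : compact A -> compact (S i @` A).
Proof.
have [L L0 hL] := affine_lipschitz (sys_affine hS i).
apply: continuous_compact; apply: continuous_subspaceT.
exact: (enorm_lipschitz_continuous hL).
Qed.

Let touch i k z : i != k -> Q i z -> Q k z -> (S i @` V) z.
Proof.
move=> ik Qz Qz'; have : (Q i `&` Q k) z by [].
by rewrite /Q (sys_inter hS ik) => -[].
Qed.

Lemma polygonal_touching_family : touching_family Q (fun i => S i @` V).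
Proof.
have [fV PE nV _] := hP; split.
- by move=> i; exact: S_compact.
- move=> i _ _ t t01 [u Pu <-] [v Pv <-]; exists (t *: u + (1 - t) *: v).
    by move: Pu Pv; rewrite PE; exact: convex_hull_convex.
  exact: affine_combo (sys_affine hS i) _ _ _.
- by move=> i; exact: finite_image.
- exact: touch.
- by move=> i k ik; rewrite /Q (sys_inter hS ik); exact: (sys_inter_le1 hS).
- move=> i _ [v Vv <-]; apply: conic_at_affine; [exact: (sys_affine hS)|exact: S_inj|].
  (* Irredundancy of [v] makes the hull of the other vertices a base missing the apex. *)
  by rewrite PE; apply: convex_hull_conic => //; exact: nV.
- exact: sys_simply_connected hS.
Qed.

Let tfQ := polygonal_touching_family.

Lemma uniform_contraction : exists2 q : R, 0 < q < 1 &
  forall i x y, enorm (S i x - S i y) <= q * enorm (x - y).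
Proof.
(* Writing the ratio as [1 - c] turns a largest ratio into a smallest [c]. Capping [c] at 1/2
   afterwards keeps the ratio positive. *)
have [c c0 hc] : exists2 c : R, 0 < c & forall i x y,
    enorm (S i x - S i y) <= (1 - c) * enorm (x - y).
  apply: uniform_pos => [i c c' _ cc' h x y|i].
    by rewrite (le_trans (h x y)) // ler_wpM2r ?enorm_ge0 //; lra.
  have [q [/andP[_ q1] hq]] := sys_contractive hS i.
  exists (1 - q); first by rewrite subr_gt0.
  by move=> x y; rewrite subKr; exact: hq.
exists (1 - Num.min c (1 / 2)).
  have : Num.min c (1 / 2) <= 1 / 2 by rewrite ge_min lexx orbT.
  have : 0 < Num.min c (1 / 2) by rewrite lt_min c0; lra.
  by move=> ? ?; apply/andP; split; lra.
move=> i x y; rewrite (le_trans (hc i x y)) // ler_wpM2r ?enorm_ge0 //.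
by rewrite lerD2l lerN2 ge_min lexx.
Qed.

Lemma uniform_expansion : exists2 r : R, 0 < r &
  forall i x y, r * enorm (x - y) <= enorm (S i x - S i y).
Proof.
apply: uniform_pos => [i c c' _ cc' h x y|i].
  by apply: le_trans (h x y); rewrite ler_wpM2r // enorm_ge0.
have [g [ag fg _]] := affine_inverse (sys_affine hS i) (sys_invertible hS i).
have [L L0 hL] := affine_lipschitz ag.
exists L^-1; first by rewrite invr_gt0.
by move=> x y; rewrite mulrC ler_pdivrMr // mulrC -{1}(fg x) -{1}(fg y).
Qed.

Lemma attractor_sub : K `<=` P.
Proof.
have [_ cK KE] := hK; have [q /andP[q0 q1] hq] := uniform_contraction.
apply: (@iterate_into_closed _ _ S q) => //; first by rewrite (ltW q0).
- by have [_ _ _ [z /interior_subset Pz]] := hP; exists z.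
- by move=> x; rewrite {1}KE.
- exact: sys_sub hS.
Qed.

(** The iteration used for [attractor_sub] applies again: [V] is covered by its images and [K] is
    invariant. *)
Lemma vertices_sub_attractor : V `<=` K.
Proof.
have [K0 cK KE] := hK; have [q /andP[q0 q1] hq] := uniform_contraction.
apply: (@iterate_into_closed _ _ S q) => //; first by rewrite (ltW q0).
- by apply: finite_compact; case: hP.
- exact: sys_vertices hS.
- by move=> i x Sx; rewrite KE; exists i.
Qed.

(** A point of [K] coming from another piece is a contact point, hence the image under [S i] of a
    vertex, and vertices lie in [K]. *)
Let K_piece i z : K z -> Q i z -> (S i @` K) z.
Proof.
have [_ _ KE] := hK; rewrite {1}KE => -[k _ [x Kx <-]] Qz.
have [<-|ik] := eqVneq k i; first by exists x.
have [v Vv <-] : (S i @` V) (S k x).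
  apply: touch Qz _; first by rewrite eq_sym; exact: ik.
  by exists x => //; exact: attractor_sub.
by exists v => //; exact: vertices_sub_attractor.
Qed.

(** The vertex [S i x] is the image of a vertex under some [S k]. If [k] differs from [i] it is a
    contact point, so injectivity of [S i] concludes in either case. *)
Let vertex_pull i x : P x -> V (S i x) -> V x.
Proof.
move=> Px /(sys_vertices hS)[k _ [v Vv vx]].
have [ik|ik] := eqVneq i k; first by rewrite -ik in vx; rewrite -(S_inj vx).
have [w Vw /S_inj <- //] : (S i @` V) (S i x).
by apply: touch ik _ _; [exists x|exists v => //; exact: VP].
Qed.

(** Free end times let subarcs and pull-backs keep their parametrization. *)
Definition arc_in (f : R -> 'rV[R]_2) (a b : R) :=
  [/\ a <= b, {within `[a, b], continuous f}, set_inj `[a, b] f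
    & forall t, a <= t <= b -> K (f t)].

Lemma arc_in_sub f a b c d : arc_in f a b -> a <= c -> c <= d -> d <= b ->
  arc_in f c d.
Proof.
move=> [ab cf fI fK] ac cd db.
have sub : `[c, d] `<=` `[a, b] by apply: subset_itv; rewrite bnd_simp.
split=> //; first exact: continuous_subspaceW cf.
  by move=> x y; rewrite !inE => cx cy; apply: fI; rewrite inE; exact: sub.
by move=> t /andP[ct td]; apply: fK; rewrite (le_trans ac) //= (le_trans td).
Qed.

Let arc_sub_union f a b : arc_in f a b -> f @` `[a, b] `<=` \bigcup_i Q i.
Proof.
move=> [_ _ _ fK] _ [t /= + <-]; rewrite in_itv /= => /fK.
have [_ _ KE] := hK; rewrite KE => -[i _ [x Kx <-]]; exists i => //.
by exists x => //; exact: attractor_sub.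
Qed.

Lemma arc_pull_back f a b i : arc_in f a b -> Q i (f a) -> Q i (f b) ->
  exists2 f', arc_in f' a b & forall t, a <= t <= b -> f t = S i (f' t).
Proof.
move=> arcf Qa Qb; have [ab cf fI fK] := arcf.
have [g [ag fg gf]] := affine_inverse (sys_affine hS i) (sys_invertible hS i).
have [L L0 hL] := affine_lipschitz ag.
exists (g \o f); last by move=> t _; rewrite /= gf.
split=> //.
- apply: (@within_continuous_comp _ _ _ _ setT g) => //.
  by apply: continuous_subspaceT; exact: (enorm_lipschitz_continuous hL).
- by move=> x y hx hy /= /(can_inj gf); exact: fI.
move=> t tab /=.
have Qt := arc_inside tfQ cf fI (arc_sub_union arcf) Qa Qb tab.
by have [x Kx <-] := K_piece (fK _ tab) Qt; rewrite fg.
Qed.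

(** * The Hoelder estimate for arcs in the attractor *)

Section Exponent.
Variables (q r D l : R).
Hypotheses (q0 : 0 < q) (q1 : q < 1) (r0 : 0 < r) (l0 : 0 < l).
Hypothesis rl : r `^ l = q.
Hypothesis Sq : forall i x y, enorm (S i x - S i y) <= q * enorm (x - y).
Hypothesis Sr : forall i x y, r * enorm (x - y) <= enorm (S i x - S i y).
Hypotheses (D0 : 0 < D) (KD : forall x y, K x -> K y -> enorm (x - y) <= D).

Definition holder (C : R) (f : R -> 'rV[R]_2) a b := forall s t,
  a <= s <= b -> a <= t <= b ->
  enorm (f s - f t) <= C * enorm (f a - f b) `^ l.

(** The factor [q] gained on the left equals the power [l] of the factor [r] on the right, so [C] is
    unchanged and the step can be iterated. *)
Lemma holder_scale C f f' a b i : 0 < C -> a <= b ->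
  (forall t, a <= t <= b -> f t = S i (f' t)) ->
  holder C f' a b -> holder C f a b.
Proof.
move=> C0 ab fE hf s t sab tab.
rewrite !fE ?lexx ?ab //; apply: (le_trans (Sq _ _ _)).
apply: (@le_trans _ _ (q * (C * enorm (f' a - f' b) `^ l))).
  by rewrite ler_wpM2l ?(ltW q0) //; exact: hf.
rewrite mulrCA ler_wpM2l ?(ltW C0) // -rl -powRM ?enorm_ge0 ?(ltW r0) //.
by apply: ge0_ler_powR; rewrite ?nnegrE ?mulr_ge0 ?enorm_ge0 ?(ltW l0) ?(ltW r0).
Qed.

Lemma holder_far C c f a b : arc_in f a b -> 0 < c -> D <= C * c `^ l ->
  0 <= C -> c <= enorm (f a - f b) -> holder C f a b.
Proof.
move=> [_ _ _ fK] c0 DC C0 cE s t sab tab.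
apply: (le_trans (KD (fK _ sab) (fK _ tab))); apply: (le_trans DC).
by rewrite ler_wpM2l // ge0_ler_powR ?nnegrE ?enorm_ge0 ?(ltW l0) ?(ltW c0).
Qed.

(* Each pull-back multiplies the distance of the end points by at least [1 / q],
   and that distance never exceeds [D], so finitely many steps suffice. *)
Lemma holder_descent C (good : (R -> 'rV[R]_2) -> R -> R -> Prop) : 0 < C ->
  (forall f a b, arc_in f a b -> good f a b -> holder C f a b \/
    exists i f', [/\ arc_in f' a b, good f' a b &
      forall t, a <= t <= b -> f t = S i (f' t)]) ->
  forall f a b, arc_in f a b -> good f a b -> holder C f a b.
Proof.
move=> C0 step f a b arcf gf.
(* Equal end points force [a = b] by injectivity, and both sides are then 0 since [l] is nonzero. *)
have [fab|fab] := pselect (f a = f b).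
  have [ab _ fI _] := arcf.
  have eab : a = b by apply: fI fab; rewrite inE /= in_itv /= lexx ab.
  move=> s t; rewrite -eab => /le_anti <- /le_anti <-.
  by rewrite subrr enorm0 powR0 ?mulr0 // gt_eqF.
have E0 := enorm_gt0 fab.
have [n hn] : exists n, q ^+ n * D < enorm (f a - f b).
  have : (fun n => q ^+ n * D) @ \oo --> (0 * D : R).
    by apply: cvgMl; apply: cvg_expr; rewrite ger0_norm // ltW.
  by rewrite mul0r => /cvgr_lt/(_ _ E0)[n _ hn]; exists n; exact: hn (leqnn n).
elim: n f {fab E0} arcf gf hn => [|n IHn] f arcf gf hn.
  have [ab _ _ fK] := arcf; move: hn; rewrite mul1r ltNge => /negP[].
  by apply: KD; apply: fK; rewrite lexx ab.
have [//|[i [f' [arcf' gf' fE]]]] := step f a b arcf gf.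
have [ab _ _ _] := arcf; apply: (holder_scale C0 ab fE); apply: IHn => //.
rewrite -(ltr_pM2l q0) mulrA -exprS; apply: lt_le_trans hn _.
by rewrite !fE ?lexx ?ab.
Qed.

(** Pull-back keeps an end point at a vertex by [vertex_pull]. When no piece contains both ends, the
    vertex is outside a piece containing the other end, hence at distance at least [c] from it. *)
Lemma holder_vertex : exists2 C, 0 < C & forall f a b, arc_in f a b ->
  V (f a) \/ V (f b) -> holder C f a b.
Proof.
have [c c0 hc] : exists2 c : R, 0 < c & forall i v u, V v -> ~ Q i v -> Q i u ->
    c <= enorm (v - u).
  apply: uniform_pos => [i c c' _ cc' h v u Vv nQ Qu|i].
    by apply: le_trans cc' _; exact: h.
  have cV : compact (V `\` Q i).
    by apply: finite_compact; apply: finite_setD; case: hP.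
  have [|c c0 hc] := compact_enorm_dist cV (@tf_compact _ _ _ _ tfQ i).
    by rewrite setDE -setIA setICl setI0.
  by exists c => // v u Vv nQ Qu; exact: hc.
have cl0 : 0 < c `^ l by rewrite powR_gt0.
pose C := D / c `^ l.
have C0 : 0 < C by rewrite divr_gt0.
exists C => //; apply: holder_descent => // f a b arcf gf.
have [ab _ _ fK] := arcf.
have Ka : K (f a) by apply: fK; rewrite lexx.
have Kb : K (f b) by apply: fK; rewrite lexx ab.
have [[i [Qa Qb]]|nQ] := pselect (exists i, Q i (f a) /\ Q i (f b)).
  right; have [f' arcf' fE] := arc_pull_back arcf Qa Qb.
  have [_ _ _ fK'] := arcf'.
  exists i, f'; split=> //.
  case: gf; rewrite fE ?lexx ?ab // => /vertex_pull Vf; [left|right];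
    by apply: Vf; apply: attractor_sub; apply: fK'; rewrite lexx ab.
left; apply: (holder_far arcf c0) => //; first by rewrite /C divfK // gt_eqF.
  exact: ltW.
have inQ z : K z -> exists i, Q i z.
  have [_ _ KE] := hK; rewrite {1}KE => -[i _ [x Kx <-]]; exists i.
  by exists x => //; exact: attractor_sub.
case: gf => Vf.
  have [i Qi] := inQ _ Kb; apply: hc (Qi) => // Qa; by apply: nQ; exists i.
rewrite enormBC.
have [i Qi] := inQ _ Ka; apply: hc (Qi) => // Qb; by apply: nQ; exists i.
Qed.

Lemma holder_arc : exists2 C, 0 < C & forall f a b, arc_in f a b -> holder C f a b.
Proof.
have [C1 C10 hC1] := holder_vertex.
have [c c0 sep] := touching_separation tfQ.
have cl0 : 0 < c `^ l by rewrite powR_gt0.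
(* [D] pays for end points at distance at least [c], and [2 * C1] for two subarcs meeting at [p];
   dividing by the power of [c] absorbs the separation constant. *)
pose C := (D + 2 * C1) / c `^ l.
have C0 : 0 < C by rewrite divr_gt0 // addr_gt0 // mulr_gt0.
exists C => // f a b arcf.
apply: (@holder_descent C (fun _ _ _ => True)) => // {}f {}a {}b {}arcf _.
have [ab cf fI fK] := arcf.
have Ka : K (f a) by apply: fK; rewrite lexx.
have Kb : K (f b) by apply: fK; rewrite lexx ab.
have [[i [Qa Qb]]|nQ] := pselect (exists i, Q i (f a) /\ Q i (f b)).
  right; have [f' arcf' fE] := arc_pull_back arcf Qa Qb.
  by exists i, f'.
left.
have inQ z : K z -> exists i, Q i z.
  have [_ _ KE] := hK; rewrite {1}KE => -[i _ [x Kx <-]]; exists i.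
  by exists x => //; exact: attractor_sub.
have [i Qa] := inQ _ Ka; have [k Qb] := inQ _ Kb.
have ik : i != k by apply/eqP => ik; apply: nQ; exists i; rewrite {2}ik.
have [cE|[p [Qp Q'p pa pb]]] := sep _ _ _ _ ik Qa Qb.
  apply: (holder_far arcf c0) => //; last exact: ltW.
  by rewrite /C divfK ?gt_eqF // lerDl mulr_ge0 // ltW.
have [e /andP[ae eb] fe] := arc_through tfQ ab cf (arc_sub_union arcf) ik Qa Qb Qp Q'p.
have ki : k != i by rewrite eq_sym.
have E0 : 0 <= enorm (f a - f b) := enorm_ge0 _.
have small x : c * enorm x <= enorm (f a - f b) ->
    C1 * enorm x `^ l <= C1 / c `^ l * enorm (f a - f b) `^ l.
  move=> hx; rewrite -mulrA ler_wpM2l ?(ltW C10) // mulrC ler_pdivlMr // mulrC.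
  rewrite -powRM ?enorm_ge0 ?(ltW c0) //.
  by apply: ge0_ler_powR; rewrite ?nnegrE ?mulr_ge0 ?enorm_ge0 ?(ltW l0) ?(ltW c0).
(* The subarc up to [p] lies in one piece; pulled back by [S i], it ends at a vertex. *)
have ha : holder C1 f a e.
  have arca := arc_in_sub arcf (lexx a) ae eb.
  have Qe : Q i (f e) by rewrite fe.
  have [f' arcf' fE] := arc_pull_back arca Qa Qe.
  have [_ _ _ fK'] := arcf'.
  apply: holder_scale (fE) _ => //; apply: hC1 => //; right.
  have [v Vv] := touch ik Qp Q'p.
  by rewrite -fe fE ?lexx ?ae // => /S_inj <-.
have hb : holder C1 f e b.
  have arcb := arc_in_sub arcf ae eb (lexx b).
  have Qe : Q k (f e) by rewrite fe.
  have [f' arcf' fE] := arc_pull_back arcb Qe Qb.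
  have [_ _ _ fK'] := arcf'.
  apply: holder_scale (fE) _ => //; apply: hC1 => //; left.
  have [v Vv] := touch ki Q'p Qp.
  by rewrite -fe fE ?lexx ?eb // => /S_inj <-.
have near_p s : a <= s <= b -> enorm (f s - p) <= C1 / c `^ l * enorm (f a - f b) `^ l.
  move=> /andP[as_ sb]; have [se|es] := leP s e.
    have := ha s e; rewrite as_ se lexx ae fe => /(_ isT isT) h.
    by apply: le_trans h _; exact: small.
  have := hb s e; rewrite (ltW es) sb lexx eb fe => /(_ isT isT) h.
  by apply: le_trans h _; rewrite enormBC; exact: small.
move=> s t sab tab; apply: (le_trans (enormB_le _ p _)).
rewrite (enormBC p); apply: (le_trans (lerD (near_p _ sab) (near_p _ tab))).
rewrite -mulrDl ler_wpM2r ?powR_ge0 // /C -mulrDl ler_wpM2r ?invr_ge0 ?(ltW cl0) //.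
by have := D0; lra.
Qed.

End Exponent.

End HolderArcs.

(** * Choice of the exponent and passage to diameters *)

Unset Implicit Arguments.

Theorem theorem3 (R : realType) (P V : set 'rV[R]_2) (m : nat)
    (S : 'I_m -> 'rV[R]_2 -> 'rV[R]_2) (K : set 'rV[R]_2)
    (hP : convex_polygon P V)
    (hS : sc_polygonal_system P V S)
    (hK : attractor S K) :
  exists C lambda : R,
    [/\ 0 < C, 0 < lambda < 1
      & forall (x y : 'rV[R]_2) (gamma : set 'rV[R]_2),
          K x -> K y -> is_arc x y gamma -> gamma `<=` K ->
          (diam gamma <= (C * enorm (x - y) `^ lambda)%:E)%E].
Proof.
have [q /andP[q0 q1] Sq] := uniform_contraction hS.
have [r' r'0 Sr'] := uniform_expansion hS.
(* Lowering the expansion bound to at most [q / 2] gives [r < q], whence [l < 1]. *)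
pose r := Num.min r' (q / 2).
have r0 : 0 < r by rewrite lt_min r'0 divr_gt0.
have rq : r < q.
  by apply: (@le_lt_trans _ _ (q / 2)); [rewrite ge_min lexx orbT|lra].
have r1 : r < 1 by exact: lt_trans q1.
have Sr i x y : r * enorm (x - y) <= enorm (S i x - S i y).
  by apply: le_trans (Sr' i x y); rewrite ler_wpM2r ?enorm_ge0 // ge_min lexx.
have lnq : ln q < 0 by rewrite ln_lt0 // q0.
have lnr : ln r < 0 by rewrite ln_lt0 // r0.
pose l := ln q / ln r.
have l0 : 0 < l by rewrite /l -divrNN divr_gt0 // oppr_gt0.
have l1 : l < 1.
  by rewrite /l -divrNN ltr_pdivrMr ?oppr_gt0 // mul1r ltrN2 ltr_ln ?posrE.
have rl : r `^ l = q.
  by rewrite /powR gt_eqF // /l divfK ?lnK ?posrE // lt_eqF.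
have [_ cK _] := hK.
have [D D0 KD] := compact_enorm_bounded cK cK.
have [C C0 hC] := holder_arc hP hS hK q0 q1 r0 l0 rl Sq Sr D0 KD.
exists C, l; split=> //; first by rewrite l0.
move=> x y gamma Kx Ky arc gK; apply: ge_ereal_sup => _ [[u v] [/= gu gv] <-].
rewrite lee_fin; case: arc => [[xy gE]|[f [cf fI f0 f1 gE]]].
  move: gu gv; rewrite gE => -> ->.
  by rewrite xy !subrr enorm0 powR0 ?mulr0 // gt_eqF.
have arcf : arc_in K f 0 1.
  split=> // t t01; apply: gK; by rewrite gE; exists t.
rewrite gE in gu gv; case: gu gv => s s01 us [t t01 vt].
by rewrite -us -vt -f0 -f1; apply: hC.
Qed.
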